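(* Let $w$ be a weight vector for $H_A(\beta)$. The set \[ \{\phi_v\mid v\text{ is an exponent of }H_A(\beta)\text{ with respect to }w\text{ that has minimal negative support}\} \] is a basis for $\mathscr{S}_w(H_A(\beta))$.
   Context: Hypergeometric systems. $\mathbb{N}=\{0,1,2,\dots\}$. $A=[a_{ij}]\in\mathbb{Z}^{d\times n}$ is a matrix whose columns $a_1,\dots,a_n$ generate $\mathbb{Z}^d$ as a group, and $\beta\in\mathbb{C}^d$ (arbitrary). $D$ is the complex Weyl algebra in $x_1,\dots,x_n,\partial_1,\dots,\partial_n$; $I_A=\langle \partial^u-\partial^v\mid u,v\in\mathbb{N}^n,\ Au=Av\rangle\subseteq\mathbb{C}[\partial_1,\dots,\partial_n]$; $E_i=\sum_{j}a_{ij}x_j\partial_j$; $H_A(\beta)=D\cdot I_A+\langle E_1-\beta_1,\dots,E_d-\beta_d\rangle$. $\ker_{\mathbb{Z}}(A)=\{u\in\mathbb{Z}^n: Au=0\}$. Weight vectors. For $w\in\mathbb{R}^n$, the $(-w,w)$-weight of $x^u\partial^v$ is $-w\cdot u+w\cdot v$; the initial form of a nonzero $f\in D$ is the sum of its terms of maximal weight; $\mathrm{in}_{(-w,w)}(J)$ is the left ideal generated by the initial forms of nonzero elements of a left ideal $J$. Similarly $\mathrm{in}_w(J)$ for an ideal $J\subseteq\mathbb{C}[\partial]$, where $\partial^v$ has weight $w\cdot v$. A vector $w\in\mathbb{R}^n_{>0}$ is a weight vector for $H_A(\beta)$ if there is a strongly convex open rational polyhedral cone $\mathscr{C}\subset\mathbb{R}^n_{>0}$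 containing $w$ such that for all $w'\in\mathscr{C}$: $\mathrm{in}_w(I_A)=\mathrm{in}_{w'}(I_A)$ and $\mathrm{in}_{(-w,w)}(H_A(\beta))=\mathrm{in}_{(-w',w')}(H_A(\beta))$. $\mathscr{C}^*=\{u\in\mathbb{R}^n: u\cdot w'\ge 0\ \forall w'\in\mathscr{C}\}$. Exponents and negative supports. $v\in\mathbb{C}^n$ is an exponent of $H_A(\beta)$ with respect to $w$ if $x^v$ is a solution of $\mathrm{in}_{(-w,w)}(H_A(\beta))$. The negative support of $v\in\mathbb{C}^n$ is $\mathrm{nsupp}(v)=\{i: v_i\in\mathbb{Z}_{<0}\}$. $v$ has minimal negative support if $\mathrm{nsupp}(v)$ does not properly contain $\mathrm{nsupp}(v+u)$ for any nonzero $u\in\ker_{\mathbb{Z}}(A)$. $N_v=\{u\in\ker_{\mathbb{Z}}(A)\mid \mathrm{nsupp}(u+v)=\mathrm{nsupp}(v)\}$ and \[ \phi_v=\sum_{u\in N_v}\frac{[v]_{u_-}}{[u+v]_{u_+}}x^{u+v},\qquad [v]_{u_-}=\prod_{u_i<0}\prod_{j=1}^{-u_i}(v_i-j+1),\quad [u+v]_{u_+}=\prod_{u_i>0}\prod_{j=1}^{u_i}(v_i+j). \] $\mathscr{S}_w(H_A(\beta))$ is the $\mathbb{C}$-vector space of logarithm-free formal series solutions of $H_A(\beta)$ in the direction of $w$, i.e. the space spanned by the formal solutions of $H_A(\beta)$ of the form $\sum_{u\in C}\lambda_ux^{v+u}$ with $v\in\mathbb{C}^n$, $\lambda_u\in\mathbb{C}$,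 and $C\subseteq\mathscr{C}^*\cap\ker_{\mathbb{Z}}(A)$ for some open cone $\mathscr{C}\ni w$ as in the definition of weight vector. *)

(* Defs.v *)
From HB Require Import structures.
From mathcomp Require Import all_boot all_order all_algebra.
From mathcomp Require Import boolp classical_sets functions fsbigop reals topology.
From mathcomp Require Import complex ssrcomplements mpoly.

Set Implicit Arguments.
Unset Strict Implicit.
Unset Printing Implicit Defensive.

Import Order.TTheory GRing.Theory Num.Theory numFieldTopology.Exports.

Local Open Scope classical_set_scope.
Local Open Scope ring_scope.

(* In a variable block of size n + n, the first n variables are x_1, ..., x_n
   and the last n are the symbols of d_1, ..., d_n. *)
Definition xpart n (m : 'X_{1..n + n}) : 'X_{1..n} :=
  [multinom m (lshift n i) | i < n].
Definition dpart n (m : 'X_{1..n + n}) : 'X_{1..n} :=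
  [multinom m (rshift n i) | i < n].

Lemma xpartE n (m : 'X_{1..n + n}) i : xpart m i = m (lshift n i).
Proof. exact: mnmE. Qed.

Lemma dpartE n (m : 'X_{1..n + n}) i : dpart m i = m (rshift n i).
Proof. exact: mnmE. Qed.

Lemma mnm_subnn n (m : 'X_{1..n}) : (m - m)%MM = 0%MM.
Proof. by apply/mnmP => i; rewrite mnmBE mnm0E subnn. Qed.

Section NormalOrdering.

Variables (F : comNzRingType) (n : nat) (V : lmodType F).

Definition pow_op (T : 'I_n -> V -> V) (m : 'X_{1..n}) (v : V) : V :=
  foldr (fun i => iter (m i) (T i)) v (enum 'I_n).

(* The operator sum_(a, b) f_(a, b) X^a D^b obtained from the normally ordered
   symbol f = sum_(a, b) f_(a, b) x^a xi^b. *)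
Definition normal_eval (X D : 'I_n -> V -> V) (f : {mpoly F[n + n]}) (v : V) : V :=
  \sum_(m <- msupp f) f@_m *: pow_op X (xpart m) (pow_op D (dpart m) v).

Record weyl_relations (X D : 'I_n -> V -> V) : Prop := WeylRelations {
  weyl_linX : forall i, linear (X i);
  weyl_linD : forall i, linear (D i);
  weyl_commX : forall i j v, X i (X j v) = X j (X i v);
  weyl_commD : forall i j v, D i (D j v) = D j (D i v);
  weyl_commDX : forall i j v, D i (X j v) = X j (D i v) + (i == j)%:R *: v }.

Lemma pow_op0 T v : pow_op T 0%MM v = v.
Proof. by rewrite /pow_op; elim: (enum _) => //= i r ->; rewrite mnm0E. Qed.

Lemma pow_op_swap (S : V -> V) T m v :
  (forall i u, S (T i u) = T i (S u)) -> S (pow_op T m v) = pow_op T m (S v).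
Proof.
move=> ST; rewrite /pow_op; elim: (enum _) => //= i r <-.
by elim: (m i) => //= k <-.
Qed.

Lemma pow_op_linear T m : (forall i, linear (T i)) -> linear (pow_op T m).
Proof.
move=> linT a u v; rewrite /pow_op; elim: (enum _) => //= i r ->.
by elim: (m i) => [|k IH] //=; rewrite IH linT.
Qed.

Lemma pow_opU T i m v : (forall i j u, T i (T j u) = T j (T i u)) ->
  pow_op T (U_(i) + m)%MM v = T i (pow_op T m v).
Proof.
move=> TC; rewrite /pow_op.
have Tit S k u : (forall w, T i (S w) = S (T i w)) ->
    T i (iter k S u) = iter k S (T i u).
  by move=> TS; elim: k => //= k <-.
have notin r : i \notin r ->
    foldr (fun j => iter ((U_(i) + m)%MM j) (T j)) v r =
    foldr (fun j => iter (m j) (T j)) v r.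
  elim: r => //= j r IH; rewrite inE negb_or => /andP[ij /IH ->].
  by rewrite mnmDE mnm1E (negbTE ij).
have: i \in enum 'I_n by rewrite mem_enum.
have: uniq (enum 'I_n) by rewrite enum_uniq.
elim: (enum _) => //= j r IH /andP[jr ur]; rewrite inE mnmDE mnm1E.
have [ij _|ij /= ir] := eqVneq i j; last by rewrite add0n IH // -Tit.
by rewrite notin ij // add1n.
Qed.

Lemma normal_evalwE X D f k v : (msize f <= k)%N ->
  normal_eval X D f v =
  \sum_(m : 'X_{1..(n + n) < k}) f@_m *: pow_op X (xpart m) (pow_op D (dpart m) v).
Proof.
move=> le_fk; rewrite /normal_eval.
rewrite (big_mksub 'X_{1..(n + n) < k}) ?msupp_uniq //=; first last.
  by move=> x /msize_mdeg_lt /leq_trans; apply.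
rewrite big_rmcond //= => j /memN_msupp_eq0 ->; by rewrite scale0r.
Qed.

Lemma normal_eval_linear X D v : linear (fun f => normal_eval X D f v).
Proof.
move=> a f g /=; pose k := maxn (msize (a *: f + g)) (maxn (msize f) (msize g)).
rewrite !(@normal_evalwE _ _ _ k) ?leq_max ?leqnn ?orbT //.
rewrite scaler_sumr -big_split /=; apply: eq_bigr => m _.
by rewrite mcoeffD mcoeffZ scalerDl scalerA.
Qed.

Lemma normal_evalX X D m v :
  normal_eval X D 'X_[m] v = pow_op X (xpart m) (pow_op D (dpart m) v).
Proof. by rewrite /normal_eval msuppX big_seq1 mcoeffX eqxx scale1r. Qed.

Lemma normal_eval1 X D v : normal_eval X D 1 v = v.
Proof.
have -> : 1 = 'X_[0] :> {mpoly F[n + n]} by rewrite mpolyX0.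
have x0 : xpart (0%MM : 'X_{1..n + n}) = 0%MM by apply/mnmP => i; rewrite xpartE !mnm0E.
have d0 : dpart (0%MM : 'X_{1..n + n}) = 0%MM by apply/mnmP => i; rewrite dpartE !mnm0E.
by rewrite normal_evalX x0 d0 !pow_op0.
Qed.

Lemma xpartU i m : xpart (U_(lshift n i) + m) = (U_(i) + xpart m)%MM.
Proof.
by apply/mnmP => j; rewrite !(xpartE, dpartE, mnmDE, mnm1E) (inj_eq (@lshift_inj _ _)).
Qed.

Lemma dpartUl i m : dpart (U_(lshift n i) + m) = dpart m.
Proof. by apply/mnmP => j; rewrite !(xpartE, dpartE, mnmDE, mnm1E) eq_lrshift. Qed.

Lemma dpartU i m : dpart (U_(rshift n i) + m) = (U_(i) + dpart m)%MM.
Proof.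
by apply/mnmP => j; rewrite !(xpartE, dpartE, mnmDE, mnm1E) (inj_eq (@rshift_inj _ _)).
Qed.

Lemma xpartUr i m : xpart (U_(rshift n i) + m) = xpart m.
Proof. by apply/mnmP => j; rewrite !(xpartE, dpartE, mnmDE, mnm1E) eq_rlshift. Qed.

Lemma xpartB i m : xpart (m - U_(lshift n i)) = (xpart m - U_(i))%MM.
Proof.
by apply/mnmP => j; rewrite !(xpartE, dpartE, mnmBE, mnm1E) (inj_eq (@lshift_inj _ _)).
Qed.

Lemma dpartB i m : dpart (m - U_(lshift n i)) = dpart m.
Proof. by apply/mnmP => j; rewrite !(xpartE, dpartE, mnmBE, mnm1E) eq_lrshift subn0. Qed.

Lemma mnm_ind (k : nat) (P : 'X_{1..k} -> Prop) :
  P 0%MM -> (forall i m, P m -> P (U_(i) + m)%MM) -> forall m, P m.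
Proof.
move=> P0 PS m; move: {2}(mdeg m) (erefl (mdeg m)) => e.
elim: e m => [|e IH] m; first by move/eqP; rewrite mdeg_eq0 => /eqP->.
move=> em; have [i mi] : exists i, m i != 0%N.
  apply/existsP; rewrite -[X in is_true X]negbK negb_exists; apply/negP => /forallP m0.
  suff m00 : m = 0%MM by move: em; rewrite m00 mdeg0.
  by apply/mnmP => i; move: (m0 i); rewrite negbK mnm0E => /eqP.
have Um : (U_(i) <= m)%MM.
  by apply/mnm_lepP => j; rewrite mnm1E; case: eqVneq => // <-; rewrite lt0n.
rewrite -(submK Um) addmC; apply/PS/IH.
by move: em; rewrite -{1}(submK Um) mdegD mdeg1 addn1 => -[].
Qed.

Lemma linear_hom (f : V -> V) : linear f ->
  [/\ f 0 = 0, (forall u v, f (u + v) = f u + f v) & forall a v, f (a *: v) = a *: f v].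
Proof.
move=> lf; have fD u v : f (u + v) = f u + f v by rewrite -[u]scale1r lf !scale1r.
have f0 : f 0 = 0 by apply: (addIr (f 0)); rewrite -fD !add0r.
by split=> // a v; rewrite -[a *: v]addr0 lf f0 addr0.
Qed.

Section Relations.

Variables (X D : 'I_n -> V -> V).
Hypothesis XD : weyl_relations X D.

Lemma pow_op_leibniz i m v :
  D i (pow_op X m v) =
  pow_op X m (D i v) + (m i)%:R *: pow_op X (m - U_(i))%MM v.
Proof.
have [linX linD XC DC DX] := XD.
elim/mnm_ind: m => [|j m IH].
  by rewrite !pow_op0 mnm0E scale0r addr0.
have [X0 XA XZ] := linear_hom (linX j).
rewrite !pow_opU // DX IH XA XZ -addrA; congr (_ + _).
rewrite mnmDE mnm1E eq_sym; have [<-|ij] := eqVneq i j; rewrite /= ?scale1r.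
  rewrite addmC addmK add1n -natr1 scalerDl scale1r; congr (_ + _).
  have [->|mi] := eqVneq (m i) 0%N; first by rewrite !scale0r.
  congr (_ *: _); rewrite -pow_opU //; congr (pow_op X _ v).
  by rewrite addmC submK //; apply/mnm_lepP => k; rewrite mnm1E; case: eqVneq => // <-; rewrite lt0n.
rewrite scale0r addr0 add0n.
have [->|mi] := eqVneq (m i) 0%N; first by rewrite !scale0r.
congr (_ *: _); rewrite -pow_opU //; congr (pow_op X _ v).
apply/mnmP => k; rewrite !(mnmDE, mnmBE, mnm1E).
by have [<-|] := eqVneq i k; rewrite ?subn0 // eq_sym (negbTE ij).
Qed.

Lemma normal_eval_lin f : linear (normal_eval X D f).
Proof.
have [linX linD _ _ _] := XD.
move=> a u v; rewrite /normal_eval scaler_sumr -big_split /=; apply: eq_bigr => m _.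
by rewrite (pow_op_linear _ linD) (pow_op_linear _ linX) scalerDr !scalerA mulrC.
Qed.

End Relations.
End NormalOrdering.

Section WeylProduct.

Variables (F : comNzRingType) (n : nat).
Implicit Types f g : {mpoly F[n + n]}.

(* Left multiplication by x_i and by d_i on normally ordered symbols; the second
   one is d_i g = g d_i + dg/dx_i. *)
Definition lmulX (i : 'I_n) g : {mpoly F[n + n]} := 'X_(lshift n i) * g.
Definition lmulD (i : 'I_n) g : {mpoly F[n + n]} :=
  'X_(rshift n i) * g + g^`M(lshift n i).

Lemma weyl_relations_lmul : weyl_relations lmulX lmulD.
Proof.
split=> [i a u v|i a u v|i j v|i j v|i j v]; rewrite /lmulX /lmulD.
- by rewrite mulrDr scalerAr.
- by rewrite mulrDr linearP scalerDr /= -scalerAr addrACA.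
- by rewrite mulrCA.
- rewrite !mderivD !mderivM !mderivX !mnm1E !eq_rlshift !scale0r !mul0r !add0r.
  rewrite !mulrDr (mulrCA 'X_(rshift n i)) (mderiv_comm (lshift n i)) -!addrA.
  by congr (_ + _); rewrite addrCA.
- rewrite mderivM mderivX mnm1E (inj_eq (@lshift_inj _ _)) mulrDr eq_sym.
  rewrite mulrCA -addrA; congr (_ + _); rewrite addrC; congr (_ + _).
  have [->|_] := eqVneq i j; last by rewrite !scale0r mul0r.
  by rewrite mnm_subnn mpolyX0 !scale1r mul1r.
Qed.

Lemma mpoly_linear_ext (V : lmodType F) (p q : {mpoly F[n + n]} -> V) :
  linear p -> linear q -> (forall m, p 'X_[m] = q 'X_[m]) -> p =1 q.
Proof.
move=> lp lq pq f.
have h0 r : linear r -> r 0 = 0 :> V.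
  move=> lr; have rD u v : r (u + v) = r u + r v by rewrite -[u]scale1r lr !scale1r.
  by apply: (addIr (r 0)); rewrite -rD !add0r.
by elim/mpolyind: f => [|c m f _ _ IH]; rewrite ?h0 // lp lq IH pq.
Qed.

Lemma normal_eval_id f : normal_eval lmulX lmulD f 1 = f.
Proof.
move: f; apply: mpoly_linear_ext => [||m].
- exact: normal_eval_linear.
- by [].
have [linX linD XC DC DX] := weyl_relations_lmul.
rewrite normal_evalX.
have -> (b : 'X_{1..n}) : pow_op lmulD b 1 =
    'X_[[multinom if fintype.split i is inr j then b j else 0%N | i < n + n]].
  elim/mnm_ind: b => [|i b IH].
    rewrite pow_op0 -mpolyX0; congr 'X_[_]; apply/mnmP => i.
    by rewrite mnmE mnm0E; case: fintype.split => // j; rewrite mnm0E.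
  rewrite pow_opU // IH /lmulD mderivX mnmE (unsplitK (inl _ _)) scale0r addr0.
  rewrite -mpolyXD; congr 'X_[_]; apply/mnmP => k.
  rewrite mnmDE mnm1E !mnmE; case: splitP => j kj.
    by rewrite -val_eqE /= kj addn0 eqn_leq leqNgt ltn_addr.
  by rewrite mnmDE mnm1E -!val_eqE /= kj eqn_add2l.
have: forall i, m (rshift n i) = dpart m i by move=> i; rewrite dpartE.
have: forall i, m (lshift n i) = xpart m i by move=> i; rewrite xpartE.
move: (xpart m) (dpart m) => a b.
elim/mnm_ind: a m => [|i a IH] m ma mb.
  rewrite pow_op0; congr 'X_[_]; apply/mnmP => k; rewrite mnmE.
  case: split_ordP => j ->; rewrite ?mb // ma mnm0E //.
rewrite pow_opU // (IH (m - U_(lshift n i))%MM).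
- rewrite /lmulX -mpolyXD addmC submK //; apply/mnm_lepP => k; rewrite mnm1E.
  by case: eqVneq => // <-; rewrite ma mnmDE mnm1E eqxx.
- move=> k; rewrite mnmBE ma mnmDE !mnm1E (inj_eq (@lshift_inj _ _)).
  by rewrite addKn.
- by move=> k; rewrite mnmBE mnm1E eq_lrshift subn0 mb.
Qed.

Section Representation.

Variables (V : lmodType F) (X D : 'I_n -> V -> V).
Hypothesis XD : weyl_relations X D.

Lemma normal_eval_lmulX i g v :
  normal_eval X D (lmulX i g) v = X i (normal_eval X D g v).
Proof.
have [linX linD XC DC DX] := XD.
move: g; apply: mpoly_linear_ext => [a f g|a f g|m].
- by rewrite /lmulX mulrDr -scalerAr (normal_eval_linear X D v).
- by rewrite (normal_eval_linear X D v) linX.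
by rewrite /lmulX -mpolyXD !normal_evalX xpartU dpartUl pow_opU.
Qed.

Lemma normal_eval_lmulD i g v :
  normal_eval X D (lmulD i g) v = D i (normal_eval X D g v).
Proof.
have [linX linD XC DC DX] := XD.
have [_ linD' _ _ _] := weyl_relations_lmul.
move: g; apply: mpoly_linear_ext => [a f g|a f g|m].
- by rewrite linD' (normal_eval_linear X D v).
- by rewrite (normal_eval_linear X D v) linD.
rewrite /lmulD -mpolyXD mderivX addrC (normal_eval_linear X D v) !normal_evalX.
by rewrite xpartB dpartB dpartU xpartUr (pow_op_leibniz XD) pow_opU // xpartE addrC.
Qed.

Lemma normal_evalM f g v :
  normal_eval X D (normal_eval lmulX lmulD f g) v =
  normal_eval X D f (normal_eval X D g v).
Proof.
move: f; apply: mpoly_linear_ext => [a f f'|a f f'|m].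
- by rewrite (normal_eval_linear _ _ g) (normal_eval_linear X D v).
- by rewrite (normal_eval_linear X D).
have powE T S (b : 'X_{1..n}) h :
    (forall i u, normal_eval X D (T i u) v = S i (normal_eval X D u v)) ->
  normal_eval X D (pow_op T b h) v = pow_op S b (normal_eval X D h v).
  move=> TS; rewrite /pow_op; elim: (enum _) => //= i r <-.
  by elim: (b i) => //= k <-.
rewrite !normal_evalX (powE _ _ _ _ (fun i u => normal_eval_lmulX i u v)).
by rewrite (powE _ _ _ _ (fun i u => normal_eval_lmulD i u v)).
Qed.

End Representation.
End WeylProduct.

(* The Weyl algebra F<x_1, ..., x_n, d_1, ..., d_n>: an operator is represented
   by its normally ordered expansion sum_(a, b) c_(a, b) x^a d^b. *)
Record weyl (F : comNzRingType) (n : nat) := Weyl { symbol : {mpoly F[n + n]} }.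

HB.instance Definition _ F n := [isNew for @symbol F n].
HB.instance Definition _ F n := [Choice of weyl F n by <:].

Section WeylRing.

Variables (F : comNzRingType) (n : nat).
Implicit Types P Q : weyl F n.

Definition weyl_zero : weyl F n := Weyl 0.
Definition weyl_opp P : weyl F n := Weyl (- symbol P).
Definition weyl_add P Q : weyl F n := Weyl (symbol P + symbol Q).
Definition weyl_one : weyl F n := Weyl 1.
Definition weyl_mul P Q : weyl F n :=
  Weyl (normal_eval (@lmulX F n) (@lmulD F n) (symbol P) (symbol Q)).

Fact weyl_addA : associative weyl_add.
Proof. by move=> P Q S; congr Weyl; apply: addrA. Qed.
Fact weyl_addC : commutative weyl_add.
Proof. by move=> P Q; congr Weyl; apply: addrC. Qed.
Fact weyl_add0 : left_id weyl_zero weyl_add.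
Proof. by case=> f; congr Weyl; apply: add0r. Qed.
Fact weyl_addN : left_inverse weyl_zero weyl_opp weyl_add.
Proof. by move=> P; congr Weyl; apply: addNr. Qed.

HB.instance Definition _ := GRing.isZmodule.Build (weyl F n)
  weyl_addA weyl_addC weyl_add0 weyl_addN.

Fact weyl_mulA : associative weyl_mul.
Proof.
by move=> P Q S; congr Weyl; rewrite /= (normal_evalM (weyl_relations_lmul _ _)).
Qed.
Fact weyl_mul1 : left_id weyl_one weyl_mul.
Proof. by case=> f; congr Weyl; apply: normal_eval1. Qed.
Fact weyl_mulr1 : right_id weyl_one weyl_mul.
Proof. by case=> f; congr Weyl; apply: normal_eval_id. Qed.
Fact weyl_mulDl : left_distributive weyl_mul weyl_add.
Proof.
move=> P Q S; congr Weyl => /=.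
by rewrite -[symbol P]scale1r normal_eval_linear !scale1r.
Qed.
Fact weyl_mulDr : right_distributive weyl_mul weyl_add.
Proof.
move=> P Q S; congr Weyl => /=.
by rewrite -[symbol Q]scale1r (normal_eval_lin (weyl_relations_lmul _ _)) !scale1r.
Qed.
Fact weyl_oner_neq0 : weyl_one != 0.
Proof. by apply/eqP => /(congr1 (@symbol F n)) /eqP; rewrite oner_eq0. Qed.

HB.instance Definition _ := GRing.Zmodule_isNzRing.Build (weyl F n)
  weyl_mulA weyl_mul1 weyl_mulr1 weyl_mulDl weyl_mulDr weyl_oner_neq0.

Definition weylC (c : F) : weyl F n := Weyl c%:MP.
Definition weylX (i : 'I_n) : weyl F n := Weyl 'X_(lshift n i).
Definition weylD (i : 'I_n) : weyl F n := Weyl 'X_(rshift n i).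

Lemma weylXE i P : weylX i * P = Weyl (lmulX i (symbol P)).
Proof.
congr Weyl; have := normal_eval_lmulX (weyl_relations_lmul F n) i 1 (symbol P).
have -> : lmulX i 1 = 'X_(lshift n i) :> {mpoly F[n + n]} by apply: mulr1.
by move=> ->; rewrite normal_eval1.
Qed.

Lemma weylDE i P : weylD i * P = Weyl (lmulD i (symbol P)).
Proof.
congr Weyl; have := normal_eval_lmulD (weyl_relations_lmul F n) i 1 (symbol P).
have -> : lmulD i 1 = 'X_(rshift n i) :> {mpoly F[n + n]}.
  by rewrite /lmulD mulr1 -mpolyC1 mderivC addr0.
by move=> ->; rewrite normal_eval1.
Qed.

Lemma weylXC i j : weylX i * weylX j = weylX j * weylX i.
Proof. by rewrite !weylXE; congr Weyl; apply: mulrC. Qed.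

Lemma weylDC i j : weylD i * weylD j = weylD j * weylD i.
Proof.
rewrite !weylDE /lmulD /= !mderivX !mnm1E !eq_rlshift !scale0r !addr0.
by rewrite mulrC.
Qed.

Lemma weylDX i j : weylD i * weylX j = weylX j * weylD i + (i == j)%:R.
Proof.
apply: val_inj; rewrite weylDE weylXE /lmulD /lmulX /=.
rewrite mderivX mnm1E (inj_eq (@lshift_inj _ _)) mulrC eq_sym; congr (_ + _).
have [->|_] := eqVneq i j; last by rewrite scale0r.
by rewrite mnm_subnn mpolyX0 scale1r.
Qed.

End WeylRing.

(* Formal sums sum_alpha f(alpha) x^alpha over alpha in F^n, given by their
   coefficients; the support is arbitrary. *)
Definition formal_series (F : comNzRingType) (n : nat) : Type := 'cV[F]_n -> F^o.

HB.instance Definition _ F n :=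
  GRing.Lmodule.copy (formal_series F n) ('cV[F]_n -> F^o).

Section FormalSeries.

Variables (F : comNzRingType) (n : nat).
Local Notation formal_series := (formal_series F n).

Definition fs_x (i : 'I_n) (f : formal_series) : formal_series :=
  fun alpha => f (alpha - delta_mx i 0).
Definition fs_d (i : 'I_n) (f : formal_series) : formal_series :=
  fun alpha => (alpha i 0 + 1) * f (alpha + delta_mx i 0).

Lemma weyl_relations_fs : weyl_relations fs_x fs_d.
Proof.
split=> [i a f g|i a f g|i j f|i j f|i j f]; apply/funext => al; rewrite /fs_x /fs_d.
- by [].
- by rewrite -[LHS]/(_ * (a * _ + _)) mulrDr mulrCA.
- by rewrite -!addrA (addrC (- _)).
- rewrite !mxE; have [->|ij] := eqVneq i j; first by [].
  by rewrite /= !addr0 mulrCA (addrAC al).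
- rewrite -[RHS]/(fs_x j (fs_d i f) al + (i == j)%:R * f al) /fs_x /fs_d.
  rewrite !mxE eqxx andbT (addrAC al).
  have [<-|_] := eqVneq i j; last by rewrite subr0 mul0r addr0.
  by rewrite !subrK -mulrDl.
Qed.

Definition weyl_act (P : weyl F n) (f : formal_series) : formal_series :=
  normal_eval fs_x fs_d (symbol P) f.

Lemma weyl_act1 f : weyl_act 1 f = f.
Proof. exact: normal_eval1. Qed.

Lemma weyl_actM P Q f : weyl_act (P * Q) f = weyl_act P (weyl_act Q f).
Proof. exact: (normal_evalM weyl_relations_fs). Qed.

Lemma weyl_actDl P Q f : weyl_act (P + Q) f = weyl_act P f + weyl_act Q f.
Proof.
by rewrite /weyl_act /= -[symbol P]scale1r normal_eval_linear !scale1r.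
Qed.

Lemma weyl_act_linear P : linear (weyl_act P).
Proof. exact: (normal_eval_lin weyl_relations_fs). Qed.

Lemma weyl_act_X i f : weyl_act (weylX F i) f = fs_x i f.
Proof.
have -> : weylX F i = weylX F i * 1 by rewrite mulr1.
by rewrite weylXE /weyl_act (normal_eval_lmulX weyl_relations_fs) normal_eval1.
Qed.

Lemma weyl_act_D i f : weyl_act (weylD F i) f = fs_d i f.
Proof.
have -> : weylD F i = weylD F i * 1 by rewrite mulr1.
by rewrite weylDE /weyl_act (normal_eval_lmulD weyl_relations_fs) normal_eval1.
Qed.

Definition is_solution (J : set (weyl F n)) (f : formal_series) : Prop :=
  forall P, J P -> weyl_act P f = 0.

Definition fs_monomial (v : 'cV[F]_n) : formal_series :=
  fun alpha => (alpha == v)%:R.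

Lemma fs_x_monomial i v : fs_x i (fs_monomial v) = fs_monomial (v + delta_mx i 0).
Proof. by apply/funext => al; rewrite /fs_x /fs_monomial subr_eq. Qed.

Lemma fs_d_monomial i v :
  fs_d i (fs_monomial v) = v i 0 *: fs_monomial (v - delta_mx i 0).
Proof.
apply/funext => al; rewrite /fs_d /fs_monomial.
rewrite -[RHS]/(v i 0 * (al == v - delta_mx i 0)%:R) eq_sym -subr_eq eq_sym.
by case: eqP => [->|]; rewrite ?mulr0 // !mxE !eqxx subrK.
Qed.

(* sum_(u in C) lam_u x^(v + u); for F of characteristic zero, every
   coefficient below is a sum with at most one nonzero term. *)
Definition fs_shifted (v : 'cV[F]_n) (C : set 'cV[int]_n) (lam : 'cV[int]_n -> F) :
    formal_series :=
  fun alpha => \sum_(u \in C) lam u * (alpha == v + map_mx intr u)%:R.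

End FormalSeries.

Section Span.

Variables (K : nzRingType) (V : lmodType K).
Implicit Types B W : set V.

Definition lspan B : set V :=
  [set x | exists s : seq (K * V),
     (forall p, p \in s -> B p.2) /\ x = \sum_(p <- s) p.1 *: p.2].

Definition lin_indep B : Prop :=
  forall (s : seq V) (c : V -> K), uniq s -> (forall b, b \in s -> B b) ->
    \sum_(b <- s) c b *: b = 0 -> forall b, b \in s -> c b = 0.

Definition is_basis B W : Prop := [/\ B `<=` W, W `<=` lspan B & lin_indep B].

End Span.

Definition left_ideal_gen (S : pzRingType) (G : set S) : set S :=
  [set x | exists s : seq (S * S),
     (forall p, p \in s -> G p.2) /\ x = \sum_(p <- s) p.1 * p.2].

Section Hypergeometric.

Variable R : realType.

Local Notation C := R[i].

Definition dotp n (u v : 'cV[R]_n) : R := \sum_i u i 0 * v i 0.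

Lemma fs_shiftedE n (v : 'cV[C]_n) (S : set 'cV[int]_n) (lam : 'cV[int]_n -> C) u :
  S u -> fs_shifted v S lam (v + map_mx intr u) = lam u.
Proof.
move=> Su; rewrite /fs_shifted -(fsbig_widen [set u] S); first last.
- move=> t [_ tu] /=; case: eqP => [|_]; last by rewrite mulr0.
  move=> /addrI /matrixP ut; case: tu; apply/matrixP => i j.
  by move: (ut i j); rewrite !mxE => /intr_inj.
- by move=> t ->.
by rewrite fsbig_set1 eqxx mulr1.
Qed.

Section InitialIdeals.

Variable n : nat.
Implicit Types w : 'cV[R]_n.

Definition init_form k (wt : 'X_{1..k} -> R) (f : {mpoly C[k]}) : {mpoly C[k]} :=
  \sum_(m <- msupp f | all (fun m' => wt m' <= wt m) (msupp f)) f@_m *: 'X_[m].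

Definition weight w (m : 'X_{1..n}) : R := \sum_i w i 0 * (m i)%:R.

Definition weyl_weight w (m : 'X_{1..n + n}) : R :=
  - weight w (xpart m) + weight w (dpart m).

Definition in_ideal w (J : set {mpoly C[n]}) : set {mpoly C[n]} :=
  left_ideal_gen [set init_form (weight w) f | f in J `\ 0].

Definition in_weyl w (J : set (weyl C n)) : set (weyl C n) :=
  left_ideal_gen [set Weyl (init_form (weyl_weight w) (symbol P)) | P in J `\ 0].

(* The inclusion of C[d_1, ..., d_n] in the Weyl algebra. *)
Definition weyl_of_dpoly (f : {mpoly C[n]}) : weyl C n :=
  Weyl (f \mPo [tuple 'X_(rshift n i) | i < n]).

(* An open rational polyhedral cone is the interior of a cone generated by
   finitely many rational vectors. *)
Definition strongly_convex_open_cone (U : set 'cV[R]_n) : Prop :=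
  exists (k : nat) (B : 'M[rat]_(n, k)),
    let sigma := [set map_mx ratr B *m t | t in [set t : 'cV[R]_k | forall j, 0 <= t j 0]] in
    (forall v, sigma v -> sigma (- v) -> v = 0) /\ U = interior sigma.

Definition dual_cone (U : set 'cV[R]_n) : set 'cV[R]_n :=
  [set u | forall w', U w' -> 0 <= dotp u w'].

Definition positive_orthant : set 'cV[R]_n := [set w | forall i, 0 < w i 0].

Definition nsupp (v : 'cV[C]_n) : set 'I_n :=
  [set i | exists2 z : int, z < 0 & v i 0 = z%:~R].

End InitialIdeals.

Variables (d n : nat) (A : 'M[int]_(d, n)).

Definition columns_generate : Prop :=
  forall b : 'cV[int]_d, exists u : 'cV[int]_n, A *m u = b.

Definition kerZ : set 'cV[int]_n := [set u | A *m u = 0].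

Definition mnm_col (u : 'X_{1..n}) : 'cV[int]_n := \col_i (u i)%:Z.

Definition toric_ideal : set {mpoly C[n]} :=
  left_ideal_gen [set f | exists u v : 'X_{1..n},
    A *m mnm_col u = A *m mnm_col v /\ f = 'X_[u] - 'X_[v]].

Definition euler_op (i : 'I_d) : weyl C n :=
  \sum_j (weylX C j * weylD C j) *~ A i j.

Definition hyp_ideal (beta : 'cV[C]_d) : set (weyl C n) :=
  [set P + Q | P in left_ideal_gen [set weyl_of_dpoly f | f in toric_ideal]
             & Q in left_ideal_gen [set euler_op i - weylC n (beta i 0) | i in setT]].

Definition weight_cone (beta : 'cV[C]_d) (w : 'cV[R]_n) (U : set 'cV[R]_n) : Prop :=
  [/\ strongly_convex_open_cone U, U `<=` @positive_orthant n, U w &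
      forall w', U w' ->
        in_ideal w toric_ideal = in_ideal w' toric_ideal /\
        in_weyl w (hyp_ideal beta) = in_weyl w' (hyp_ideal beta)].

Definition is_weight_vector (beta : 'cV[C]_d) (w : 'cV[R]_n) : Prop :=
  positive_orthant w /\ exists U, weight_cone beta w U.

Definition is_exponent (beta : 'cV[C]_d) (w : 'cV[R]_n) (v : 'cV[C]_n) : Prop :=
  is_solution (in_weyl w (hyp_ideal beta)) (fs_monomial v).

Definition min_nsupp (v : 'cV[C]_n) : Prop :=
  forall u, kerZ u -> u != 0 -> ~ (nsupp (v + map_mx intr u) `<` nsupp v).

Definition Nset (v : 'cV[C]_n) : set 'cV[int]_n :=
  [set u | kerZ u /\ nsupp (map_mx intr u + v) = nsupp v].

Definition falling_neg (v : 'cV[C]_n) (u : 'cV[int]_n) : C :=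
  \prod_(i | u i 0 < 0) \prod_(1 <= j < (absz (u i 0)).+1) (v i 0 - j%:R + 1).

(* [u + v]_(u_+), whose factors are v_i + j *)
Definition rising_pos (v : 'cV[C]_n) (u : 'cV[int]_n) : C :=
  \prod_(i | 0 < u i 0) \prod_(1 <= j < (absz (u i 0)).+1) (v i 0 + j%:R).

Definition phi (v : 'cV[C]_n) : formal_series C n :=
  fs_shifted v (Nset v) (fun u => falling_neg v u / rising_pos v u).

(* Series supported on v + C, C contained in the integral kernel of A and in the
   dual of some cone as in the definition of a weight vector. *)
Definition directed_series (beta : 'cV[C]_d) (w : 'cV[R]_n) : set (formal_series C n) :=
  [set f | exists U v (S : set 'cV[int]_n) lam,
     [/\ weight_cone beta w U,
         S `<=` [set u | dual_cone U (map_mx intr u)] `&` kerZ &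
         f = fs_shifted v S lam]].

Definition log_free_solutions (beta : 'cV[C]_d) (w : 'cV[R]_n) : set (formal_series C n) :=
  lspan [set f | directed_series beta w f /\ is_solution (hyp_ideal beta) f].

End Hypergeometric.

(* Main.v *)
From HB Require Import structures.
Require Import Defs.
From mathcomp Require Import all_boot all_order all_algebra.
From mathcomp Require Import boolp classical_sets functions fsbigop reals topology.
From mathcomp Require Import complex ssrcomplements mpoly zify lra.

(* The toric operators d^m - d^m' relate the coefficients of a solution f on
   a + ker A.  Along a step u with nsupp (a + u) = nsupp a the relation determines
   f (a + u) from f a, and along a step which strictly shrinks the negative support
   it forces f a = 0.  So the support of a log-free solution consists of vectors of
   minimal negative support, and on each class of equal negative support f is a
   multiple of phi; there are at most 2^n classes in v + ker A.
   If x^v is killed by the initial ideal for one, hence all, w' in the open cone U,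
   then u in N_v has w'.u >= 0: otherwise d^(u_-) is an initial form which does not
   kill x^v.  Hence N_v lies in the dual of U.  The same argument, applied to the
   w-initial part of phi on a class, shows that this part is a single monomial, which
   is therefore an exponent in the class. *)

Set Implicit Arguments.
Unset Strict Implicit.
Unset Printing Implicit Defensive.

Import Order.TTheory GRing.Theory Num.Theory numFieldTopology.Exports.

Local Open Scope classical_set_scope.
Local Open Scope ring_scope.

(** * Coefficientwise action of normally ordered operators *)

Section SeriesOperators.

Variables (F : comNzRingType) (n : nat).
Implicit Types (a : 'cV[F]_n) (m : 'X_{1..n}) (f : formal_series F n).

Definition mnm_emb m : 'cV[F]_n := \col_i (m i)%:R.

(** The Pochhammer factor Gamma(a + m + 1) / Gamma(a + 1): d^m sends x^(a + m) to [rise a m] times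
    x^a. *)
Definition rise a m : F := \prod_i \prod_(j < m i) (a i 0 + j.+1%:R).

Lemma riseU i a m : rise a (U_(i) + m)%MM = (a i 0 + 1) * rise (a + delta_mx i 0) m.
Proof.
rewrite /rise (bigD1 i) // [in RHS](bigD1 i) //= mulrA; congr (_ * _).
  rewrite mnmDE mnm1E eqxx add1n big_ord_recl; congr (_ * _).
  by apply: eq_bigr => j _; rewrite !mxE eqxx -addrA nat1r.
apply: eq_bigr => k ki; rewrite mnmDE mnm1E eq_sym (negbTE ki) add0n.
by apply: eq_bigr => j _; rewrite !mxE (negbTE ki) addr0.
Qed.

Lemma fs_d_pow m f a : pow_op (@fs_d F n) m f a = rise a m * f (a + mnm_emb m).
Proof.
have [_ _ _ DC _] := weyl_relations_fs F n.
elim/mnm_ind: m a => [|i m IH] a.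
  rewrite pow_op0 /rise big1 ?mul1r => [|i _]; last by rewrite mnm0E big_ord0.
  by congr f; apply/colP => i; rewrite !mxE mnm0E addr0.
rewrite pow_opU // /fs_d IH riseU mulrA; congr (_ * f _).
apply/colP => j; rewrite !mxE mnmDE mnm1E natrD -addrA; congr (_ + (_ + _)).
by rewrite eqxx andbT eq_sym.
Qed.

Lemma fs_x_pow m f a : pow_op (@fs_x F n) m f a = f (a - mnm_emb m).
Proof.
have [_ _ XC _ _] := weyl_relations_fs F n.
elim/mnm_ind: m a => [|i m IH] a.
  by rewrite pow_op0; congr f; apply/colP => i; rewrite !mxE mnm0E subr0.
rewrite pow_opU // /fs_x IH; congr f.
apply/colP => j; rewrite !mxE mnmDE mnm1E natrD opprD addrA.
by rewrite eqxx andbT eq_sym.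
Qed.

Definition mon_act (m : 'X_{1..n + n}) f : formal_series F n := fun a =>
  rise (a - mnm_emb (xpart m)) (dpart m) *
  f (a - mnm_emb (xpart m) + mnm_emb (dpart m)).

Lemma normal_eval_fsX (m : 'X_{1..n + n}) f :
  normal_eval (@fs_x F n) (@fs_d F n) 'X_[m] f = mon_act m f.
Proof. by rewrite normal_evalX; apply/funext => a; rewrite fs_x_pow fs_d_pow. Qed.

Lemma weyl_actE (P : weyl F n) f a :
  weyl_act P f a = \sum_(m <- msupp (symbol P)) (symbol P)@_m * mon_act m f a.
Proof.
rewrite /weyl_act /normal_eval; elim: (msupp _) => [|m s IH].
  by rewrite !big_nil.
by rewrite !big_cons -IH -normal_eval_fsX -normal_evalX.
Qed.

(** Built as a sum of unit exponents to match the product of variables that [weyl_of_dpoly]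
    substitutes for d^m. *)
Definition dmon m : 'X_{1..n + n} := (\sum_i U_(rshift n i) *+ m i)%MM.

Lemma dmon_r m i : dmon m (rshift n i) = m i.
Proof.
rewrite /dmon mnm_sumE (bigD1 i) //= mulmnE mnm1E eqxx mul1n big1 ?addn0 // => j ji.
by rewrite mulmnE mnm1E (inj_eq (@rshift_inj _ _)) (negbTE ji).
Qed.

Lemma dmon_l m i : dmon m (lshift n i) = 0%N.
Proof. by rewrite /dmon mnm_sumE big1 // => j _; rewrite mulmnE mnm1E eq_rlshift. Qed.

Lemma dpart_dmon m : dpart (dmon m) = m.
Proof. by apply/mnmP => i; rewrite dpartE dmon_r. Qed.

Lemma xpart_dmon m : xpart (dmon m) = 0%MM.
Proof. by apply/mnmP => i; rewrite xpartE dmon_l mnm0E. Qed.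

Lemma mon_act_dmon m f a : mon_act (dmon m) f a = rise a m * f (a + mnm_emb m).
Proof.
rewrite /mon_act dpart_dmon xpart_dmon.
have -> : mnm_emb 0%MM = 0 by apply/colP => i; rewrite !mxE mnm0E.
by rewrite subr0.
Qed.

End SeriesOperators.

(** Expanding each cofactor into monomials leaves only monomial multiples of generators to test.
    This suits evaluation at one coefficient, which is linear but not multiplicative. *)
Lemma linear_ideal0 (F : comNzRingType) n (V : lmodType F) (g : {mpoly F[n]} -> V)
    (G : set {mpoly F[n]}) : linear g ->
  (forall p m, G p -> g ('X_[m] * p) = 0) -> forall p, left_ideal_gen G p -> g p = 0.
Proof.
move=> lg gG _ [s [sG ->]].
have gD p q : g (p + q) = g p + g q by rewrite -[p]scale1r lg !scale1r.
have g0 : g 0 = 0 by apply: (addIr (g 0)); rewrite -gD !add0r.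
elim: s sG => [|p s IH] sG; first by rewrite big_nil g0.
rewrite big_cons gD IH => [|q qs]; last by apply: sG; rewrite inE qs orbT.
have Gp := sG p (mem_head _ _).
rewrite addr0; elim/mpolyind: (p.1) => [|c m q _ _ IHq]; first by rewrite mul0r g0.
by rewrite mulrDl -scalerAl lg gG // scaler0 add0r.
Qed.

(** * Evaluation of an operator at one coefficient *)

Section ActionAtPoint.

Variables (F : comNzRingType) (n : nat) (f : formal_series F n) (a : 'cV[F]_n).

(** With [f] and [a] fixed this is additive in the operator, so the generic morphism lemmas split
    sums of operators. *)
Definition act_at (P : weyl F n) : F := weyl_act P f a.

Fact act_at_is_additive : {morph act_at : P Q / P - Q}.
Proof.
have D P Q : act_at (P + Q) = act_at P + act_at Q.
  by rewrite /act_at weyl_actDl.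
move=> P Q; apply: (addIr (act_at Q)).
by rewrite -D !subrK.
Qed.

HB.instance Definition _ :=
  GRing.isZmodMorphism.Build (weyl F n) F act_at act_at_is_additive.

End ActionAtPoint.

(** * Negative supports and toric binomials *)

Section Integral.

Variables (R : realType) (n : nat).
Local Notation C := R[i].
Implicit Types (a : 'cV[C]_n) (m : 'X_{1..n}) (u v : 'cV[int]_n).
Implicit Types (f : formal_series C n).

Definition emb u : 'cV[C]_n := map_mx intr u.

Lemma embD u v : emb (u + v) = emb u + emb v.
Proof. by apply/colP => i; rewrite !mxE intrD. Qed.

Lemma embN u : emb (- u) = - emb u.
Proof. by apply/colP => i; rewrite !mxE intrN. Qed.

Lemma embB u v : emb (u - v) = emb u - emb v.
Proof. by rewrite embD embN. Qed.

Lemma emb0 : emb 0 = 0.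
Proof. by apply/colP => i; rewrite !mxE. Qed.

Lemma emb_inj : injective emb.
Proof.
by move=> u v /colP uv; apply/colP => i; move: (uv i); rewrite !mxE => /intr_inj.
Qed.

Lemma mnm_embE m : mnm_emb C m = emb (mnm_col m).
Proof. by apply/colP => i; rewrite !mxE. Qed.

(* The exponent u_- of the negative part of u; [npart (- u)] is u_+. *)
Definition npart u : 'X_{1..n} :=
  [multinom (if (u i 0 < 0)%R then absz (u i 0)%R else 0%N) | i < n].

Lemma npart_sub u : mnm_col (npart (- u)) - mnm_col (npart u) = u.
Proof.
apply/colP => i; rewrite !mxE !mnmE !mxE oppr_lt0; move: (u i 0) => z.
by case: ltgtP => /= z0; rewrite ?z0 ?sub0r ?subr0 ?abszN //; lia.
Qed.

Lemma nsupp_add_mnm a m : nsupp (a + mnm_emb C m) `<=` nsupp a.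
Proof.
move=> i [z z0]; rewrite !mxE => /eqP; rewrite eq_sym -subr_eq => /eqP az.
exists (z - (m i)%:Z); first lia.
by rewrite -az intrB.
Qed.

(** A factor a_i + j with 1 <= j <= m_i vanishes exactly when a_i is a negative integer and a_i +
    m_i is not, that is, when [i] leaves the negative support. *)
Lemma rise_neq0 a m : rise a m != 0 <-> nsupp a `<=` nsupp (a + mnm_emb C m).
Proof.
rewrite prodf_seq_neq0; split.
  move=> /allP nz i [z z0 az]; exists (z + (m i)%:Z); last by rewrite !mxE az intrD.
  rewrite ltNge; apply/negP => zm.
  have := nz i; rewrite mem_index_enum => /(_ isT) /=.
  rewrite prodf_seq_neq0 => /allP nzi.
  (* The vanishing factor would be a_i + |z|; its index is |z| - 1 because the factors start at a_i
     + 1. *)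
  have jm : ((absz z).-1 < m i)%N by lia.
  have := nzi (Ordinal jm); rewrite mem_index_enum => /(_ isT) /=.
  rewrite az pmulrn -intrD intr_eq0; lia.
move=> sub; apply/allP => i _ /=; rewrite prodf_seq_neq0; apply/allP => j _ /=.
apply/negP => /eqP /addr0_eq; rewrite pmulrn.
move=> aj; have az : a i 0 = (- (Posz j.+1))%:~R by rewrite -[LHS]opprK aj intrN.
have [|z z0] := sub i; first by exists (- (Posz j.+1)).
rewrite !mxE az pmulrn -intrD => /intr_inj.
have := ltn_ord j; lia.
Qed.

(** Each coordinate of a - u_- is the lower of a_i and a_i + u_i, so it is a negative integer
    exactly when one of these is. *)
Lemma nsupp_npart a u :
  nsupp (a - mnm_emb C (npart u)) = nsupp a `|` nsupp (a + emb u).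
Proof.
apply/seteqP; split=> i.
  move=> [z z0]; rewrite !mxE mnmE => az.
  case: ifP az => ui az; [right|left].
    exists z => //; rewrite !mxE -az; congr (_ + _).
    by rewrite pmulrn -intrN; congr intr; lia.
  by exists z => //; rewrite -az subr0.
case=> -[z z0]; rewrite ?mxE => az.
  exists (z - (npart u i)%:Z); first lia.
  by rewrite !mxE az intrB.
exists (z - u i 0 - (npart u i)%:Z); first by rewrite mnmE; case: ifP; lia.
by rewrite !mxE 2!intrB -az addrK.
Qed.

Lemma npart_subr a u : a - mnm_emb C (npart u) + mnm_emb C (npart (- u)) = a + emb u.
Proof. by rewrite -{3}(npart_sub u) embB !mnm_embE -addrA (addrC (emb _)). Qed.

Lemma rise_npart_neq0 a u : nsupp (a + emb u) `<=` nsupp a ->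
  rise (a - mnm_emb C (npart u)) (npart u) != 0.
Proof. by move=> /setUidPl au; apply/rise_neq0; rewrite subrK nsupp_npart au. Qed.

Lemma weyl_of_dpolyX m : weyl_of_dpoly 'X_[m] = Weyl 'X_[dmon m] :> weyl C n.
Proof.
congr Weyl; rewrite comp_mpolyX /dmon -mprodXnE.
by apply: eq_bigr => i _; rewrite tnth_mktuple.
Qed.

Lemma act_at_dpolyX f a m :
  act_at f a (weyl_of_dpoly 'X_[m]) = rise a m * f (a + mnm_emb C m).
Proof.
by rewrite weyl_of_dpolyX /act_at weyl_actE msuppX big_seq1 mcoeffX eqxx mul1r mon_act_dmon.
Qed.

Lemma act_at_dpolyD f a (p q : {mpoly C[n]}) (c : C) :
  act_at f a (weyl_of_dpoly (c *: p + q)) =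
  c * act_at f a (weyl_of_dpoly p) + act_at f a (weyl_of_dpoly q).
Proof.
by rewrite /act_at /weyl_of_dpoly comp_mpolyD comp_mpolyZ /weyl_act normal_eval_linear.
Qed.

Lemma act_at_dpolyB f a (p q : {mpoly C[n]}) :
  act_at f a (weyl_of_dpoly (p - q)) =
  act_at f a (weyl_of_dpoly p) - act_at f a (weyl_of_dpoly q).
Proof.
have -> : weyl_of_dpoly (p - q) = weyl_of_dpoly p - weyl_of_dpoly q.
  by rewrite /weyl_of_dpoly comp_mpolyB.
exact: raddfB.
Qed.

Lemma act_at_binomial f a m m' :
  act_at f a (weyl_of_dpoly ('X_[m] - 'X_[m'])) =
  rise a m * f (a + mnm_emb C m) - rise a m' * f (a + mnm_emb C m').
Proof.
apply: etrans (act_at_dpolyB f a _ _) _.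
by congr (_ - _); apply: act_at_dpolyX.
Qed.

End Integral.

(** * Solutions as coefficient recurrences *)

Section Solutions.

Variables (R : realType) (d n : nat) (A : 'M[int]_(d, n)).
Local Notation C := R[i].
Implicit Types (a v : 'cV[C]_n) (m : 'X_{1..n}) (u : 'cV[int]_n).
Implicit Types (f : formal_series C n) (beta : 'cV[C]_d).

Lemma act_at_euler beta f a i :
  act_at f a (euler_op R A i - weylC n (beta i 0)) =
  ((map_mx intr A *m a) i 0 - beta i 0) * f a.
Proof.
rewrite raddfB /= mulrBl; congr (_ - _).
  rewrite raddf_sum mxE mulr_suml; apply: eq_bigr => j _.
  rewrite raddfMz /= /act_at weyl_actM weyl_act_X weyl_act_D /fs_x /fs_d.
  by rewrite !mxE eqxx !subrK -mulrA mulrzl.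
rewrite /act_at /weyl_act /weylC /= -[_%:MP]addr0 -alg_mpolyC normal_eval_linear.
by rewrite normal_eval1 /normal_eval msupp0 big_nil addr0.
Qed.

Definition toric_recurrence f := forall a m m',
  A *m mnm_col m = A *m mnm_col m' ->
  rise a m * f (a + mnm_emb C m) = rise a m' * f (a + mnm_emb C m').

Lemma mnm_colD m m' : mnm_col (m + m') = mnm_col m + mnm_col m'.
Proof. by apply/colP => i; rewrite !mxE mnmDE. Qed.

Lemma left_ideal_gen_in (S : pzRingType) (G : set S) x : G x -> left_ideal_gen G x.
Proof.
move=> Gx; exists [:: (1, x)]; split=> [p|]; first by rewrite inE => /eqP ->.
by rewrite big_seq1 mul1r.
Qed.

Lemma left_ideal_gen0 (S : pzRingType) (G : set S) : left_ideal_gen G 0.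
Proof. by exists [::]; split=> //; rewrite big_nil. Qed.

Lemma weyl_act_zero (P : weyl C n) : weyl_act P 0 = 0.
Proof. by have [] := linear_hom (weyl_act_linear P). Qed.

Lemma left_ideal_gen_solution (G : set (weyl C n)) f :
  is_solution G f -> is_solution (left_ideal_gen G) f.
Proof.
move=> Gf _ [s [sG ->]]; apply/funext => a.
rewrite -[LHS]/(act_at f a _) raddf_sum big_seq big1 // => p /sG /Gf pf /=.
by rewrite /act_at weyl_actM pf weyl_act_zero.
Qed.

Lemma hyp_binomial beta m m' : A *m mnm_col m = A *m mnm_col m' ->
  hyp_ideal A beta (weyl_of_dpoly ('X_[m] - 'X_[m'] : {mpoly C[n]})).
Proof.
move=> mm'; exists (weyl_of_dpoly ('X_[m] - 'X_[m'])).
  apply: left_ideal_gen_in; exists ('X_[m] - 'X_[m']) => //.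
  by apply: left_ideal_gen_in; exists m, m'.
by exists 0; [exact: left_ideal_gen0 | rewrite addr0].
Qed.

Lemma hyp_euler beta i : hyp_ideal A beta (euler_op R A i - weylC n (beta i 0)).
Proof.
exists 0; first exact: left_ideal_gen0.
exists (euler_op R A i - weylC n (beta i 0)); last by rewrite add0r.
by apply: left_ideal_gen_in; exists i.
Qed.

(** The Euler operators act diagonally, multiplying the coefficient at [a] by (A a - beta)_i.
    Monomial multiples of toric binomials are again toric binomials, so the recurrence covers the
    whole toric ideal. *)
Lemma solutionP beta f : is_solution (hyp_ideal A beta) f <->
  toric_recurrence f /\ (forall a, f a != 0 -> map_mx intr A *m a = beta).
Proof.
split=> [sf|[rf ef]].
  split=> [a m m' mm'|a fa].
    have : act_at f a (weyl_of_dpoly ('X_[m] - 'X_[m'])) = 0.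
      by rewrite /act_at sf //; apply: hyp_binomial.
    by rewrite act_at_binomial => /subr0_eq.
  apply/colP => i; have : act_at f a (euler_op R A i - weylC n (beta i 0)) = 0.
    by rewrite /act_at sf //; apply: hyp_euler.
  rewrite act_at_euler => /eqP.
  by rewrite mulf_eq0 (negbTE fa) orbF subr_eq0 => /eqP.
move=> _ [P HP [Q HQ <-]].
rewrite weyl_actDl (left_ideal_gen_solution _ HP) ?(left_ideal_gen_solution _ HQ) ?addr0 //.
- move=> _ [i _ <-]; apply/funext => a; rewrite -[LHS]/(act_at f a _) act_at_euler.
  have [->|/ef ->] := eqVneq (f a) 0; first by rewrite mulr0.
  by rewrite subrr mul0r.
- move=> _ [p Ip <-]; apply/funext => a.
  apply: (@linear_ideal0 _ _ C^o (fun p => act_at f a (weyl_of_dpoly p)) _ _ _ _ Ip).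
    by move=> c q r; apply: act_at_dpolyD.
  move=> _ k [m [m' [mm' ->]]]; rewrite mulrBr -!mpolyXD act_at_binomial.
  by apply/eqP; rewrite subr_eq0; apply/eqP/rf; rewrite !mnm_colD !mulmxDr mm'.
Qed.

End Solutions.

(** * Coefficients of symbols *)

Lemma weyl_act_sum (F : comNzRingType) n (s : seq 'X_{1..n + n}) (Q : pred 'X_{1..n + n})
    (c : 'X_{1..n + n} -> F) (f : formal_series F n) a :
  weyl_act (Weyl (\sum_(m <- s | Q m) c m *: 'X_[m])) f a =
  \sum_(m <- s | Q m) c m * mon_act m f a.
Proof.
rewrite /weyl_act /=; elim: s => [|m s IH].
  by rewrite !big_nil /normal_eval msupp0 big_nil.
rewrite !big_cons; case: ifP => // _.
by rewrite normal_eval_linear -IH -normal_eval_fsX.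
Qed.

Lemma msupp_binomial (F : comNzRingType) k (m m' : 'X_{1..k}) : m != m' ->
  perm_eq (msupp ('X_[m] - 'X_[m'] : {mpoly F[k]})) [:: m; m'].
Proof.
move=> mm'; apply: perm_trans (msuppD _) _.
  move=> x /=; rewrite (perm_mem (msuppN _)) !msuppX !inE; apply/negP => /andP[/eqP ->].
  by rewrite (negbTE mm').
by rewrite msuppX perm_cons; apply: perm_trans (msuppN _) _; rewrite msuppX.
Qed.

Section SymbolCoefficient.

Variables (F : comNzRingType) (n : nat) (m : 'X_{1..n + n}).

Definition symbol_coef (P : weyl F n) : F := (symbol P)@_m.

Fact symbol_coef_is_additive : {morph symbol_coef : P Q / P - Q}.
Proof. by move=> P Q; rewrite /symbol_coef mcoeffB. Qed.

HB.instance Definition _ :=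
  GRing.isZmodMorphism.Build (weyl F n) F symbol_coef symbol_coef_is_additive.

Lemma symbol_coefXD i : symbol_coef (weylX F i * weylD F i) =
  ((U_(lshift n i) + U_(rshift n i))%MM == m)%:R.
Proof. by rewrite /symbol_coef weylXE /= /lmulX -mpolyXD mcoeffX. Qed.

Lemma symbol_coefC c : symbol_coef (weylC n c) = c * (m == 0%MM)%:R.
Proof. by rewrite /symbol_coef /= mcoeffC eq_sym. Qed.

End SymbolCoefficient.

(** * Initial forms and initial parts of series *)

Section InitialForms.

Variables (R : realType) (n : nat).
Local Notation C := R[i].
Implicit Types (w : 'cV[R]_n) (u : 'cV[int]_n) (a b : 'cV[C]_n).
Implicit Types (f g : formal_series C n).

Lemma init_form_binomial k (wt : 'X_{1..k} -> R) m m' : wt m' < wt m ->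
  init_form wt ('X_[m] - 'X_[m']) = 'X_[m].
Proof.
move=> wmm'; have mm' : m != m' by apply: contraTN wmm' => /eqP ->; rewrite ltxx.
have sm := @msupp_binomial C _ _ _ mm'.
rewrite /init_form (perm_big _ sm) !big_cons big_nil !(perm_all _ sm) /=.
rewrite !lexx (ltW wmm') (lt_geF wmm') /= addr0 mcoeffB !mcoeffX eqxx.
by rewrite eq_sym (negbTE mm') subr0 scale1r.
Qed.

Lemma init_form_homog k (wt : 'X_{1..k} -> R) c (p : {mpoly C[k]}) :
  (forall m, m \in msupp p -> wt m = c) -> init_form wt p = p.
Proof.
move=> pc; rewrite [RHS]mpolyE /init_form big_seq_cond [RHS]big_seq.
apply: eq_bigl => m; have [mp|//] := boolP (m \in msupp p).
by rewrite /=; apply/allP => m' m'p; rewrite !pc.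
Qed.

Definition zweight w u : R := dotp (map_mx intr u) w.

Lemma zweightD w u v : zweight w (u + v) = zweight w u + zweight w v.
Proof.
by rewrite /zweight /dotp -big_split; apply: eq_bigr => i _; rewrite !mxE intrD mulrDl.
Qed.

Lemma zweightN w u : zweight w (- u) = - zweight w u.
Proof. by rewrite /zweight /dotp -sumrN; apply: eq_bigr => i _; rewrite !mxE intrN mulNr. Qed.

Lemma zweight_mnm w m : zweight w (mnm_col m) = weight w m.
Proof. by apply: eq_bigr => i _; rewrite !mxE mulrC. Qed.

Lemma mon_act_shift m f a u :
  mon_act m f (a + emb R u) = rise (a + emb R u - mnm_emb C (xpart m)) (dpart m) *
    f (a + emb R (u - mnm_col (xpart m) + mnm_col (dpart m))).
Proof. by rewrite /mon_act !mnm_embE embD embB !addrA. Qed.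

Lemma zweight_mon w m u :
  zweight w (u - mnm_col (xpart m) + mnm_col (dpart m)) = zweight w u + weyl_weight w m.
Proof. by rewrite !zweightD zweightN !zweight_mnm addrA. Qed.

(* The w-initial part of a series supported on [a + Z^n] whose minimal weight is
   attained at [a]. *)
Definition init_series w a f : formal_series C n :=
  fun b => if `[< exists2 u, b = a + emb R u & zweight w u = 0 >] then f b else 0.

Lemma init_seriesE w a f u :
  init_series w a f (a + emb R u) = if zweight w u == 0 then f (a + emb R u) else 0.
Proof.
rewrite /init_series; case: eqP => [u0|u0]; first by rewrite ifT //; apply/asboolP; exists u.
by rewrite ifF //; apply/asboolP => -[t /addrI /emb_inj <-].
Qed.

(** At a + k a monomial [m] of [P] reads a coefficient of [f] of weight
    [zweight w k + weyl_weight w m]. Where the top monomials read weight 0, the lower ones read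
    negative weights, at which [f] vanishes; there the initial form acts on the initial part as [P]
    acts on [f]. *)
Lemma init_series_kill w a f (P : weyl C n) :
  (forall u, f (a + emb R u) != 0 -> 0 <= zweight w u) -> weyl_act P f = 0 ->
  weyl_act (Weyl (init_form (weyl_weight w) (symbol P))) (init_series w a f) = 0.
Proof.
move=> fa Pf; apply/funext => b; rewrite /init_form weyl_act_sum.
pose top m := all (fun m' => weyl_weight w m' <= weyl_weight w m) (msupp (symbol P)).
rewrite (eq_bigl top) //.
(* Only at points whose weight is minus the top weight of [P] can a top monomial meet the initial
   part. *)
have [[m0 [k [m0P m0top -> wk]]]|no] := pselect (exists m k,
    [/\ m \in msupp (symbol P), top m, b = a + emb R k & zweight w k = - weyl_weight w m]).
  have low : \sum_(m <- msupp (symbol P) | ~~ top m)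
      (symbol P)@_m * mon_act m f (a + emb R k) = 0.
    apply: big1_seq => m /andP[ntop mP]; rewrite mon_act_shift.
    have [->|/fa] := eqVneq (f (a + emb R (k - mnm_col (xpart m) + mnm_col (dpart m)))) 0.
      by rewrite !mulr0.
    rewrite zweight_mon wk addrC subr_ge0 => m0m; case/negP: ntop.
    by apply/allP => m' m'P; apply: le_trans m0m; apply: (allP m0top).
  have : weyl_act P f (a + emb R k) = 0 by rewrite Pf.
  rewrite weyl_actE (bigID top) /= low addr0 => top0; rewrite -[RHS]top0.
  rewrite big_seq_cond [RHS]big_seq_cond; apply: eq_bigr => m /andP[mP mtop].
  rewrite !mon_act_shift init_seriesE zweight_mon wk.
  have -> : weyl_weight w m = weyl_weight w m0.
    by apply/le_anti; rewrite (allP m0top) ?(allP mtop).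
  by rewrite addNr eqxx.
rewrite big1_seq // => m /andP[mtop mP]; rewrite /mon_act /init_series.
case: ifPn => [|_]; last by rewrite !mulr0.
move=> /asboolP[u bu u0]; case: no.
exists m, (u + mnm_col (xpart m) - mnm_col (dpart m)); split=> //.
  by rewrite embB embD -!mnm_embE !addrA -bu [_ + _ + mnm_emb C (xpart m)]addrAC subrK addrK.
by rewrite !zweightD zweightN !zweight_mnm u0 add0r /weyl_weight opprD opprK.
Qed.

End InitialForms.

(** * Gamma quotients *)

Section GammaRatio.

Variables (F : fieldType).

(* [Gamma (z + 1) / Gamma (z + k + 1)] as a rational function of [z], with the
   value [0] at its poles. *)
Definition gamma_ratio (z : F) (k : int) : F :=
  if k < 0 then \prod_(1 <= j < (absz k).+1) (z - j%:R + 1)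
  else (\prod_(1 <= j < (absz k).+1) (z + j%:R))^-1.

(** The functional equation of Gamma: for k >= 0 the factor z + k + 1 cancels against its inverse,
    and for k < 0 it is the last factor of the product. *)
Lemma gamma_ratio_step z k : z + k%:~R + 1 != 0 ->
  (z + k%:~R + 1) * gamma_ratio z (k + 1) = gamma_ratio z k.
Proof.
case: k => p.
  have -> : Posz p + 1 = Posz p.+1 by lia.
  move=> nz; rewrite /gamma_ratio /= [in LHS]big_nat_recr //= invfM.
  by rewrite -natr1 addrA mulrCA divff // mulr1.
case: p => [|p] _.
  by rewrite /gamma_ratio /= big_nat1 !big_geq // invr1 mulr1.
have -> : Negz p.+1 + 1 = Negz p by lia.
rewrite /gamma_ratio /= [in RHS]big_nat_recr //= mulrC; congr (_ * (_ + _ + 1)).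
Qed.

Lemma gamma_ratio_iter z k m : \prod_(j < m) (z + k%:~R + j.+1%:R) != 0 ->
  \prod_(j < m) (z + k%:~R + j.+1%:R) * gamma_ratio z (k + m%:Z) = gamma_ratio z k.
Proof.
elim: m => [|m IH]; first by rewrite big_ord0 mul1r addr0.
rewrite big_ord_recr /= mulf_eq0 negb_or => /andP[nz nzm].
rewrite -mulrA -[RHS]IH //; congr (_ * _).
have e : z + k%:~R + m.+1%:R = z + (k + m%:Z)%:~R + 1.
  by rewrite -natr1 intrD !addrA.
have -> : k + m.+1%:Z = k + m%:Z + 1 by lia.
by rewrite e gamma_ratio_step // -e.
Qed.

Lemma rise_gamma_ratio n (v : 'cV[F]_n) (k : 'cV[int]_n) m :
  rise (v + map_mx intr k) m != 0 ->
  rise (v + map_mx intr k) m *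
    \prod_i gamma_ratio (v i 0) ((k + mnm_col m) i 0) =
  \prod_i gamma_ratio (v i 0) (k i 0).
Proof.
rewrite /rise prodf_seq_neq0 => /allP nz; rewrite -big_split.
apply: eq_bigr => i _; have := nz i; rewrite mem_index_enum => /(_ isT) /=.
by rewrite !mxE; apply: gamma_ratio_iter.
Qed.

(** Coordinates with k_i = 0 contribute 1, so the coefficients of [phi] become one product over all
    coordinates, to which the functional equation applies. *)
Lemma gamma_ratio_prod n (v : 'cV[F]_n) (k : 'cV[int]_n) :
  (\prod_(i | (k i 0 < 0)%R) \prod_(1 <= j < (absz (k i 0)).+1) (v i 0 - j%:R + 1)) /
  (\prod_(i | (0 < k i 0)%R) \prod_(1 <= j < (absz (k i 0)).+1) (v i 0 + j%:R)) =
  \prod_i gamma_ratio (v i 0) (k i 0).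
Proof.
rewrite -prodfV (big_mkcond (fun i => k i 0 < 0)) (big_mkcond (fun i => 0 < k i 0)).
rewrite -big_split; apply: eq_bigr => i _ /=; rewrite /gamma_ratio; move: (v i 0) (k i 0) => z l.
case: ltgtP => [_|_|->]; rewrite ?invr1 ?mulr1 ?mul1r //.
by rewrite big_geq // invr1.
Qed.

End GammaRatio.

(** * The series phi and classes of equal negative support *)

Section Phi.

Variables (R : realType) (d n : nat) (A : 'M[int]_(d, n)).
Local Notation C := R[i].
Implicit Types (a b v : 'cV[C]_n) (m : 'X_{1..n}) (u : 'cV[int]_n).
Implicit Types (f g : formal_series C n) (beta : 'cV[C]_d).

Lemma fs_shifted_neq0 v (S : set 'cV[int]_n) (c : 'cV[int]_n -> C) b :
  fs_shifted v S c b != 0 -> exists2 u, S u & b = v + emb R u.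
Proof.
apply: contra_neqP => no; rewrite /fs_shifted fsbig1 // => u Su.
by case: eqP => [bu|_]; [case: no; exists u | rewrite mulr0].
Qed.

Lemma phiE v u : Nset A v u ->
  phi A v (v + emb R u) = \prod_i gamma_ratio (v i 0) (u i 0).
Proof.
by move=> Nu; rewrite /phi fs_shiftedE // gamma_ratio_prod.
Qed.

Lemma Nset0 v : Nset A v 0.
Proof. by split; [exact: mulmx0 | rewrite -/(emb R 0) emb0 add0r]. Qed.

Lemma phi_self v : phi A v v = 1.
Proof.
have := phiE (Nset0 v); rewrite emb0 addr0 => ->.
by rewrite big1 // => i _; rewrite mxE /gamma_ratio /= big_geq // invr1.
Qed.

Lemma NsetE v u : Nset A v u <-> A *m u = 0 /\ nsupp (v + emb R u) = nsupp v.
Proof. by rewrite /Nset /kerZ /= addrC. Qed.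

(** If one side is nonzero, then [a] has the negative support of [v]. Adding m' can only shrink it,
    and minimality of [v] forbids a strict loss, so a + m' lies in the class as well. Both sides
    then equal the Gamma quotient at [a]. *)
Lemma phi_toric v : min_nsupp A v -> toric_recurrence A (phi A v).
Proof.
(* The relation is symmetric in m and m', so a nonzero left side is enough. *)
move=> vmin; have key a m m' : A *m mnm_col m = A *m mnm_col m' ->
    rise a m * phi A v (a + mnm_emb C m) != 0 ->
    rise a m * phi A v (a + mnm_emb C m) = rise a m' * phi A v (a + mnm_emb C m').
  move=> mm'; rewrite mulf_eq0 negb_or => /andP[ra /fs_shifted_neq0[u Nu au]].
  have [Au nu] := (NsetE v u).1 Nu.
  have aE : a = v + emb R (u - mnm_col m).
    by rewrite embB addrA -au mnm_embE addrK.
  have na : nsupp a = nsupp v.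
    rewrite -nu -au; apply/seteqP; split; first exact/rise_neq0.
    exact: nsupp_add_mnm.
  pose u' := u - mnm_col m + mnm_col m'.
  have au' : a + mnm_emb C m' = v + emb R u' by rewrite mnm_embE aE -addrA -embD.
  have Au' : A *m u' = 0 by rewrite mulmxDr mulmxBr Au mm' sub0r addNr.
  have nu' : nsupp (v + emb R u') `<=` nsupp v by rewrite -au' -na; apply: nsupp_add_mnm.
  have vu' : nsupp v `<=` nsupp (v + emb R u').
    have [->|u'0] := eqVneq u' 0; first by rewrite emb0 addr0.
    by apply: contrapT => no; apply: (vmin u').
  have Nu' : Nset A v u' by apply/NsetE; split=> //; apply/seteqP.
  have ra' : rise a m' != 0 by apply/rise_neq0; rewrite na au'.
  rewrite au au' !phiE //; rewrite aE in ra ra' *.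
  rewrite /u' (rise_gamma_ratio ra') -[RHS](rise_gamma_ratio ra).
  by congr (_ * _); apply: eq_bigr => i _; rewrite subrK.
move=> a m m' mm'.
have [l0|] := eqVneq (rise a m * phi A v (a + mnm_emb C m)) 0; last exact: key.
have [->//|/key] := eqVneq (rise a m' * phi A v (a + mnm_emb C m')) 0.
by move/(_ m (esym mm')).
Qed.

(* The value that the binomial d^(u_-) - d^(u_+) forces on [f (a + u) / f a]. *)
Definition class_ratio a u : C :=
  rise (a - mnm_emb C (npart u)) (npart u) / rise (a - mnm_emb C (npart u)) (npart (- u)).

Lemma npart_ker u : A *m u = 0 -> A *m mnm_col (npart u) = A *m mnm_col (npart (- u)).
Proof. by rewrite -{1}(npart_sub u) mulmxBr => /subr0_eq. Qed.

(** No coordinate leaves the negative support from a - u_- to [a] or to a + u, so both factors of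
    the binomial relation are invertible. *)
Lemma toric_class f a u : toric_recurrence A f -> Nset A a u ->
  f (a + emb R u) = class_ratio a u * f a /\ class_ratio a u != 0.
Proof.
move=> rf /NsetE[Au nu].
have r1 : rise (a - mnm_emb C (npart u)) (npart u) != 0.
  by apply: rise_npart_neq0; rewrite nu.
have r2 : rise (a - mnm_emb C (npart u)) (npart (- u)) != 0.
  by apply/rise_neq0; rewrite npart_subr nsupp_npart nu setUid.
split; last by rewrite mulf_neq0 ?invr_eq0.
have := rf (a - mnm_emb C (npart u)) _ _ (npart_ker Au).
rewrite subrK npart_subr /class_ratio mulrAC => ->.
by rewrite mulrAC divff // mul1r.
Qed.

Lemma toric_phi_class f a u : toric_recurrence A f -> min_nsupp A a -> Nset A a u ->
  f (a + emb R u) = f a * phi A a (a + emb R u).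
Proof.
move=> rf /phi_toric rp Nu; have [-> _] := toric_class rf Nu.
by have [-> _] := toric_class rp Nu; rewrite phi_self mulr1 mulrC.
Qed.

(** If a + u had strictly smaller negative support, the side of the relation containing [f a] would
    be nonzero. The factor on the other side would then be nonzero too, forcing [nsupp a] into that
    of a + u. *)
Lemma toric_min_nsupp f a : toric_recurrence A f -> f a != 0 -> min_nsupp A a.
Proof.
move=> rf fa u Au u0 [sub nsub]; apply: nsub.
have := rf (a - mnm_emb C (npart u)) _ _ (npart_ker Au); rewrite subrK => e.
have : rise (a - mnm_emb C (npart u)) (npart (- u)) != 0.
  have : rise (a - mnm_emb C (npart u)) (npart u) * f a != 0.
    by rewrite mulf_neq0 // rise_npart_neq0.
  by rewrite e mulf_eq0 negb_or => /andP[].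
by move/rise_neq0; rewrite npart_subr nsupp_npart => s i ai; apply: s; left.
Qed.

End Phi.

(** * Weight estimates on open cones *)

Section Cones.

Variables (R : realType) (n : nat).
Implicit Types (w : 'cV[R]_n) (u : 'cV[int]_n) (U : set 'cV[R]_n).

(** Move [w] inside [U] along the i-th axis against the sign of u_i: nonnegativity of the pairing at
    the new point is the bound. *)
Lemma dual_cone_bound U w : open U -> U w ->
  exists2 r : R, 0 < r &
    forall u, dual_cone U (map_mx intr u) -> forall i, r * `|(u i 0)%:~R| <= zweight w u.
Proof.
rewrite openE => oU /oU; rewrite /interior /= => /nbhs_ballP[e /= e0 eU].
(* Half the radius, since balls are defined by a strict inequality. *)
exists (e / 2); first by rewrite divr_gt0.
move=> u Uu i; pose t : R := - Num.sg (u i 0)%:~R * (e / 2).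
have : U (w + t *: delta_mx i 0).
  apply: eU; split=> // j k; rewrite /ball /= !mxE opprD addrA subrr sub0r normrN.
  have [_|_] /= := boolP ((j == i) && (k == 0)); rewrite ?mulr0 ?normr0 //.
  rewrite mulr1 /t normrM normrN normr_sg (gtr0_norm (divr_gt0 e0 _)) //.
  by case: (_ != 0); rewrite ?mul1r ?mul0r //; lra.
move/Uu; suff -> : dotp (map_mx intr u) (w + t *: delta_mx i 0) =
  zweight w u - (e / 2) * `|(u i 0)%:~R| by rewrite subr_ge0.
rewrite /zweight /dotp (bigD1 i) // [in RHS](bigD1 i) //= !mxE !eqxx /= mulr1.
rewrite mulrDr -!addrA; congr (_ + _).
rewrite addrC; congr (_ + _).
  by apply: eq_bigr => j ji; rewrite !mxE (negbTE ji) /= mulr0 addr0.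
by rewrite /t mulNr mulrN normrEsg mulrC mulrAC mulrC.
Qed.

Lemma dual_cone_eq0 U w u : open U -> U w ->
  dual_cone U (map_mx intr u) -> dual_cone U (map_mx intr (- u)) -> u = 0.
Proof.
move=> oU Uw Uu UNu; have [r r0 rU] := dual_cone_bound oU Uw.
have lw0 : zweight w u <= 0 by rewrite -oppr_ge0 -zweightN; apply: UNu.
apply/colP => i; rewrite mxE; apply/eqP; rewrite -(@intr_eq0 R) -normr_le0.
by rewrite -(pmulr_rle0 _ r0); apply: le_trans lw0; apply: rU.
Qed.

(** Vectors of [T] no heavier than [u0] lie in a finite box of integer points, where a minimum
    exists. *)
Lemma zweight_min w (r : R) (T : set 'cV[int]_n) u0 : 0 < r -> T u0 ->
  (forall u i, T u -> r * `|(u i 0)%:~R| <= zweight w u) ->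
  exists2 u, T u & forall u', T u' -> zweight w u <= zweight w u'.
Proof.
move=> r0 Tu0 Tr.
pose K := Num.bound (zweight w u0 / r).
(* Ordinals 0, ..., 2K shifted by -K enumerate the integers from -K to K. *)
pose dec (t : 'cV['I_(K.*2.+1)]_n) : 'cV[int]_n := \col_i ((t i 0 : nat)%:Z - K%:Z).
have decP u : T u -> zweight w u <= zweight w u0 -> exists t, u = dec t.
  move=> Tu uu0; exists (\col_i inord (absz (u i 0 + K%:Z))).
  apply/colP => i; rewrite !mxE.
  have : (absz (u i 0)%R < K)%N.
    rewrite -(ltr_nat R) natr_absz intr_norm; apply: (@le_lt_trans _ _ (zweight w u0 / r)).
      by rewrite ler_pdivlMr // mulrC; apply: le_trans (Tr _ _ Tu) uu0.
    apply: archi_boundP; rewrite divr_ge0 ?(ltW r0) //; apply: le_trans uu0.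
    by apply: le_trans (Tr _ i Tu); rewrite mulr_ge0 ?(ltW r0).
  by move: (u i 0) => z zK; rewrite inordK; lia.
have [t0 t0P] := decP _ Tu0 (lexx _).
have Pt0 : `[< T (dec t0) >] by apply/asboolP; rewrite -t0P.
case: (arg_minP (P := fun t => `[< T (dec t) >]) (fun t => zweight w (dec t)) Pt0).
move=> t /asboolP Tt tmin; exists (dec t) => // u Tu.
have [uu0|] := leP (zweight w u) (zweight w u0).
  by have [t' ut'] := decP _ Tu uu0; rewrite ut'; apply/tmin/asboolP; rewrite -ut'.
by move=> /ltW; apply: le_trans; rewrite t0P; apply: tmin.
Qed.

End Cones.

(** * Exponents and the initial ideal *)

Section Exponents.

Variables (R : realType) (d n : nat) (A : 'M[int]_(d, n)) (beta : 'cV[R[i]]_d).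
Local Notation C := R[i].
Local Notation H := (hyp_ideal A beta).
Implicit Types (a b v : 'cV[C]_n) (m : 'X_{1..n}) (u : 'cV[int]_n).
Implicit Types (f g : formal_series C n) (w : 'cV[R]_n) (U : set 'cV[R]_n).

Lemma weight_dmon w m : weyl_weight w (dmon m) = weight w m.
Proof.
rewrite /weyl_weight xpart_dmon dpart_dmon [X in - X]big1 ?oppr0 ?add0r // => i _.
by rewrite mnm0E mulr0.
Qed.

Lemma weight_cone_open w U : weight_cone A beta w U -> open U.
Proof. by case=> -[k [B [_ ->]]] _ _ _; apply: open_interior. Qed.

Lemma in_weyl_binomial w m m' : A *m mnm_col m = A *m mnm_col m' ->
  weight w m' < weight w m -> in_weyl w H (Weyl 'X_[dmon m]).
Proof.
move=> mm' wm; rewrite -!weight_dmon in wm.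
apply: left_ideal_gen_in; exists (Weyl ('X_[dmon m] - 'X_[dmon m'])); last first.
  by rewrite (init_form_binomial wm).
split.
  have := hyp_binomial beta mm'; congr (H _).
  have /(congr1 (@symbol _ _)) := weyl_of_dpolyX R m.
  have /(congr1 (@symbol _ _)) := weyl_of_dpolyX R m'.
  by rewrite /weyl_of_dpoly /= comp_mpolyB => -> ->.
move=> /(congr1 (fun P => (symbol P)@_(dmon m))) /=.
rewrite mcoeffB !mcoeffX eqxx mcoeff0.
have -> : (dmon m' == dmon m) = false.
  by apply/eqP => e; move: wm; rewrite e ltxx.
by rewrite subr0 => /eqP; rewrite oner_eq0.
Qed.

(** Stated for any solution [g] of the initial ideal: it serves both for x^v with [v] an exponent
    and for the initial part of a phi series before that is known to be a monomial. *)
Lemma Nset_dual_cone w U g a u : weight_cone A beta w U ->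
  is_solution (in_weyl w H) g -> g a != 0 -> Nset A a u ->
  dual_cone U (map_mx intr u).
Proof.
move=> [_ _ _ inU] sg ga /NsetE[Au nu] w' Uw'; rewrite leNgt; apply/negP.
rewrite -/(zweight w' u) -{1}(npart_sub u) zweightD zweightN !zweight_mnm subr_lt0 => wu.
have := in_weyl_binomial (npart_ker Au) wu.
rewrite -(inU _ Uw').2 => /sg /(congr1 (fun g => g (a - mnm_emb C (npart u)))).
rewrite weyl_actE /= msuppX big_seq1 mcoeffX eqxx mul1r mon_act_dmon subrK.
move/eqP; rewrite mulf_eq0 (negbTE ga) orbF; apply/negP.
by apply: rise_npart_neq0; rewrite nu.
Qed.

(** All terms of an Euler operator have weight 0, so it is its own initial form and kills x^v. *)
Lemma exponent_euler w v : is_exponent A beta w v -> map_mx intr A *m v = beta.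
Proof.
move=> ev; apply/colP => i.
have : weyl_act (euler_op R A i - weylC n (beta i 0)) (fs_monomial v) = 0.
  set P := euler_op _ _ _ - _.
  (* Initial forms are taken of nonzero elements only, so a zero operator is treated apart. *)
  have [->|P0] := eqVneq P 0.
    by apply/funext => a; rewrite -[LHS]/(act_at (fs_monomial v) a 0) raddf0.
  have -> : P = Weyl (init_form (weyl_weight w) (symbol P)).
    rewrite (@init_form_homog _ _ _ 0); first by case: (P).
    move=> m; rewrite mcoeff_msupp; apply: contra_neqP => wm.
    rewrite -[LHS]/(symbol_coef m P) raddfB raddf_sum big1 => [|j _]; last first.
      rewrite /= raddfMz /= symbol_coefXD; case: eqP => [mE|_]; last exact: mul0rz.
      case: wm; rewrite -mE /weyl_weight addrC; apply/eqP; rewrite subr_eq0; apply/eqP.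
      apply: eq_bigr => k _; rewrite xpartE dpartE !mnmDE !mnm1E.
      rewrite !(inj_eq (@lshift_inj _ _)) !(inj_eq (@rshift_inj _ _)).
      by rewrite eq_rlshift eq_lrshift addn0.
    rewrite /= symbol_coefC; case: eqP => [m0|_]; last by rewrite mulr0 subr0.
    case: wm; rewrite m0 /weyl_weight [X in - X]big1 => [|k _]; last by rewrite xpartE mnm0E mulr0.
    by rewrite oppr0 add0r; apply: big1 => k _; rewrite dpartE mnm0E mulr0.
  apply: ev; apply: left_ideal_gen_in; exists P => //; split; last exact/eqP.
  exact: hyp_euler.
move=> /(congr1 (fun g => g v)); rewrite -/(act_at (fs_monomial v) v _) act_at_euler.
by rewrite /fs_monomial eqxx mulr1 => /subr0_eq.
Qed.

Lemma mulmx_emb a u : A *m u = 0 ->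
  map_mx intr A *m (a + emb R u) = map_mx intr A *m a.
Proof. by move=> Au; rewrite mulmxDr -map_mxM Au map_mx0 addr0. Qed.

Lemma phi_solution w v : is_exponent A beta w v -> min_nsupp A v ->
  is_solution H (phi A v).
Proof.
move=> ev vmin; apply/solutionP; split; first exact: phi_toric.
move=> a /fs_shifted_neq0[u /NsetE[Au _] ->].
by rewrite mulmx_emb // (exponent_euler ev).
Qed.

Lemma phi_directed w U v : weight_cone A beta w U -> is_exponent A beta w v ->
  directed_series A beta w (phi A v).
Proof.
move=> wU ev; exists U, v, (Nset A v); eexists; split=> // u Nu; split; last by case: Nu.
by apply: (Nset_dual_cone wU ev _ Nu); rewrite /fs_monomial eqxx oner_eq0.
Qed.

(** Two exponents in one class differ by some [u] with both u and -u in the dual of the open cone,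
    hence u = 0. *)
Lemma phi_exponent_inj w U v v' : weight_cone A beta w U ->
  is_exponent A beta w v -> is_exponent A beta w v' -> phi A v' v != 0 -> v = v'.
Proof.
move=> wU ev ev' /fs_shifted_neq0[u Nu vE].
have [Au nu] := (NsetE _ _ _).1 Nu.
have mon1 (x : 'cV[C]_n) : fs_monomial x x != 0 :> C by rewrite /fs_monomial eqxx oner_eq0.
have Uu := Nset_dual_cone wU ev' (mon1 v') Nu.
have NNu : Nset A v (- u).
  by apply/NsetE; rewrite mulmxN Au oppr0 vE nu embN addrK.
have UNu := Nset_dual_cone wU ev (mon1 v) NNu.
have [_ _ Uw _] := wU.
by rewrite vE (dual_cone_eq0 (weight_cone_open wU) Uw Uu UNu) emb0 addr0.
Qed.

(** The exponent is the point of the support of [f] in the class of [a] with least w-weight; the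
    dual cone bound makes this minimum exist. *)
Lemma class_exponent w f a : directed_series A beta w f -> is_solution H f ->
  f a != 0 -> exists e, [/\ is_exponent A beta w e, f e != 0 &
    exists2 u, Nset A a u & e = a + emb R u].
Proof.
move=> [U [v [S [c [wU SU fE]]]]] sf fa.
have [rf ef] := (solutionP _ _ _).1 sf; have [_ _ Uw _] := wU.
have oU := weight_cone_open wU; have [r r0 rU] := dual_cone_bound oU Uw.
pose T := [set s | S s /\ exists2 u, Nset A a u & v + emb R s = a + emb R u].
have fS b : f b != 0 -> exists2 s, S s & b = v + emb R s.
  by rewrite fE => /fs_shifted_neq0.
have [s0 Ss0 as0] := fS a fa.
have Ts0 : T s0 by split=> //; exists 0; [exact: Nset0 | rewrite emb0 addr0].
have [|s [Ss [t Nt st]] smin] := zweight_min (w := w) r0 Ts0.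
  by move=> u i [/SU[Uu _] _]; apply: rU.
pose e := v + emb R s.
have fe : f e != 0.
  by have [feq cr] := toric_class rf Nt; rewrite /e st feq mulf_neq0.
have emin := toric_min_nsupp rf fe.
have [At nt] := (NsetE _ _ _).1 Nt.
(* On its class [f] vanishes nowhere, so minimality over the support of [f] bounds the support of
   [phi A e] too. *)
have ge0 u : phi A e (e + emb R u) != 0 -> 0 <= zweight w u.
  move=> /fs_shifted_neq0[u' Nu' /addrI /emb_inj ->].
  have [Au' nu'] := (NsetE _ _ _).1 Nu'.
  have /fS[s' Ss' es'] : f (e + emb R u') != 0.
    by have [-> cr] := toric_class rf Nu'; rewrite mulf_neq0.
  have : T s'.
    split=> //; exists (t + u'); last by rewrite -es' /e st embD addrA.
    by apply/NsetE; rewrite mulmxDr At Au' addr0 embD addrA -st nu' /e st nt.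
  move/smin; suff -> : s' = s + u' by rewrite zweightD lerDl.
  by apply/(@emb_inj R)/(addrI v); rewrite embD addrA -es'.
pose g := init_series w e (phi A e).
have sg : is_solution (in_weyl w H) g.
  apply: left_ideal_gen_solution => _ [P [HP _] <-]; apply: init_series_kill => //.
  move: P HP; apply/solutionP; split; first exact: phi_toric.
  move=> b /fs_shifted_neq0[u /NsetE[Au _] ->].
  by rewrite mulmx_emb // ef.
have gu u : g (e + emb R u) != 0 -> Nset A e u /\ zweight w u = 0.
  rewrite /g init_seriesE; have [u0|_] := eqVneq (zweight w u) 0; last by rewrite eqxx.
  by move=> /fs_shifted_neq0[u' Nu' /addrI /emb_inj uu']; split=> //; rewrite uu'.
have gE : g = fs_monomial e.
  have ge : g e = 1.
    have := init_seriesE w e (phi A e) 0; rewrite emb0 addr0 phi_self -/g => ->.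
    by rewrite ifT // /zweight /dotp big1 // => i _; rewrite !mxE mul0r.
  apply/funext => b; rewrite /fs_monomial; case: eqP => [->//|be].
  have [//|gb] := eqVneq (g b) 0; case: be.
  have [u bE] : exists u, b = e + emb R u.
    move: gb; rewrite /g /init_series; case: ifP => [/asboolP[u -> _] _|_]; last by rewrite eqxx.
    by exists u.
  have gb' := gb; rewrite bE in gb'; have [Nu _] := gu _ gb'.
  have [Au nu] := (NsetE _ _ _).1 Nu.
  (* As [g] is nonzero at both [e] and [b], the dual cone argument applies from either end and gives
     u and -u. *)
  have Uu : dual_cone U (map_mx intr u).
    by apply: (Nset_dual_cone wU sg _ Nu); rewrite ge oner_eq0.
  have UNu : dual_cone U (map_mx intr (- u)).
    apply: (Nset_dual_cone wU sg gb'); apply/NsetE.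
    by rewrite mulmxN Au oppr0 nu embN addrK.
  by rewrite bE (dual_cone_eq0 oU Uw Uu UNu) emb0 addr0.
exists e; split; [by rewrite /is_exponent -gE; exact: sg | exact: fe |].
by exists t; [exact: Nt | exact: st].
Qed.

End Exponents.

(** * Linear spans *)

Section Span.

Variables (K : nzRingType) (V : lmodType K).
Implicit Types (B W : set V) (x y : V).

Lemma lspan0 B : lspan B 0.
Proof. by exists [::]; rewrite big_nil. Qed.

Lemma lspan_add B x y : lspan B x -> lspan B y -> lspan B (x + y).
Proof.
move=> [s [sB ->]] [t [tB ->]]; exists (s ++ t); rewrite big_cat; split=> // p.
by rewrite mem_cat => /orP[/sB|/tB].
Qed.

Lemma lspan_scale B c x : lspan B x -> lspan B (c *: x).
Proof.
move=> [s [sB ->]]; exists [seq (c * p.1, p.2) | p <- s]; split.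
  by move=> _ /mapP[p /sB Bp ->].
by rewrite big_map scaler_sumr; apply: eq_bigr => p _; rewrite scalerA.
Qed.

Lemma lspan_in B x : B x -> lspan B x.
Proof.
move=> Bx; exists [:: (1, x)]; rewrite big_seq1 scale1r; split=> // p.
by rewrite inE => /eqP ->.
Qed.

Lemma lspan_sum B (I : Type) (s : seq I) (P : pred I) (x : I -> V) :
  (forall i, P i -> lspan B (x i)) -> lspan B (\sum_(i <- s | P i) x i).
Proof. by move=> Bx; elim/big_ind: _ => //; [exact: lspan0 | exact: lspan_add]. Qed.

Lemma lspan_sub B W : B `<=` lspan W -> lspan B `<=` lspan W.
Proof.
move=> BW _ [s [sB ->]]; rewrite big_seq; apply: lspan_sum => p /sB Bp.
by apply/lspan_scale/BW.
Qed.

End Span.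

Lemma fs_sumE (F : comNzRingType) n (I : Type) (s : seq I) (P : pred I)
    (g : I -> formal_series F n) b :
  (\sum_(i <- s | P i) g i) b = \sum_(i <- s | P i) g i b.
Proof. exact: (big_morph (fun h : formal_series F n => h b)). Qed.

(** * Spanning and independence *)

Section Basis.

Variables (R : realType) (d n : nat) (A : 'M[int]_(d, n)) (beta : 'cV[R[i]]_d).
Local Notation C := R[i].
Variable w : 'cV[R]_n.
Implicit Types (a b v : 'cV[C]_n) (f : formal_series C n).

Definition canonical_series : set (formal_series C n) :=
  [set phi A v | v in [set v | is_exponent A beta w v /\ min_nsupp A v]].

(** The support of [f] lies in one coset of the kernel, so each subset of the coordinates is the
    negative support of at most one class meeting it. A finite sum over subsets therefore recovers
    [f]. *)
Lemma directed_solution_span f : directed_series A beta w f ->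
  is_solution (hyp_ideal A beta) f -> lspan canonical_series f.
Proof.
move=> df sf; have [rf _] := (solutionP _ _ _).1 sf.
have ker a b : f a != 0 -> f b != 0 -> nsupp a = nsupp b ->
    exists2 u, Nset A a u & b = a + emb R u.
  have [U [v [S [c [_ SU fE]]]]] := df; rewrite fE.
  move=> /fs_shifted_neq0[s /SU[_ As] ->] /fs_shifted_neq0[t /SU[_ At] ->] nst.
  have e : v + emb R t = v + emb R s + emb R (t - s).
    by rewrite -addrA -embD (addrC s) subrK.
  exists (t - s) => //; apply/NsetE; split; last by rewrite -e.
  by rewrite mulmxBr As At subrr.
pose P (I : {set 'I_n}) v := [/\ is_exponent A beta w v, f v != 0 & nsupp v = [set` I]].
pose E I := `[< exists v, P I v >].
(* The default 0 never enters the sum, which is restricted to [E I]. *)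
pose rep I := xget 0 (P I).
have repP I : E I -> P I (rep I).
  by move=> /asboolP[v Pv]; apply: xgetPex; exists v.
have -> : f = \sum_(I : {set 'I_n} | E I) f (rep I) *: phi A (rep I).
  apply/funext => b; rewrite fs_sumE.
  have term0 I : E I -> phi A (rep I) b != 0 ->
      [/\ f b != 0, nsupp b = [set` I] & f b = f (rep I) * phi A (rep I) b].
    move=> /repP[_ frep nrep] /fs_shifted_neq0[u Nu ->].
    have rmin := toric_min_nsupp rf frep; have [_ nu] := (NsetE _ _ _).1 Nu.
    split; [|by rewrite nu|exact: toric_phi_class].
    by have [-> cr] := toric_class rf Nu; rewrite mulf_neq0.
  have [fb|fb] := eqVneq (f b) 0.
    rewrite big1 // => I EI; have [e|/(term0 I EI)[]] := eqVneq (phi A (rep I) b) 0.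
      by rewrite -[LHS]/(f (rep I) * phi A (rep I) b) e mulr0.
    by rewrite fb eqxx.
  pose I0 := [set i | `[< nsupp b i >]]%SET.
  have nI0 : nsupp b = [set` I0].
    by apply/seteqP; split=> i /=; rewrite inE => /asboolP.
  have EI0 : E I0.
    have [v [ev fv [u /NsetE[_ nu] vE]]] := class_exponent df sf fb.
    by apply/asboolP; exists v; split=> //; rewrite vE nu.
  (* At [b] only the summand indexed by the negative support of [b] survives. *)
  rewrite (bigD1 I0) //= big1 ?addr0 => [|I /andP[EI II0]].
    have [_ frep nrep] := repP _ EI0.
    have [u Nu ->] := ker _ _ frep fb (etrans nrep (esym nI0)).
    by apply: toric_phi_class => //; apply: toric_min_nsupp frep.
  have [e|/(term0 I EI)[_ nI _]] := eqVneq (phi A (rep I) b) 0.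
    by rewrite -[LHS]/(f (rep I) * phi A (rep I) b) e mulr0.
  have /seteqP[s1 s2] : [set` I0] = [set` I] by rewrite -nI0.
  by case/eqP: II0; apply/setP => i; apply/idP/idP; [exact: s2 | exact: s1].
apply: lspan_sum => I /repP[erep frep _]; apply/lspan_scale/lspan_in.
by exists (rep I) => //; split=> //; apply: toric_min_nsupp frep.
Qed.

(** Evaluate a relation at the exponent [v]: [phi A v] takes the value 1 there, and the phi series
    of every other exponent in the family vanishes. *)
Lemma canonical_series_indep : is_weight_vector A beta w -> lin_indep canonical_series.
Proof.
move=> [_ [U wU]] s c us sB s0 b bs; have [v [ev vmin] bE] := sB _ bs.
have : (\sum_(b' <- s) c b' *: b') v = 0 by rewrite s0.
rewrite fs_sumE (bigD1_seq b) //= big_seq_cond big1 ?addr0.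
  by rewrite -[LHS]/(c b * b v) -bE phi_self mulr1.
move=> b' /andP[/sB[v' [ev' _] <-] b'b].
have [e|/(phi_exponent_inj wU ev ev') vv'] := eqVneq (phi A v' v) 0.
  by rewrite -[LHS]/(_ * phi A v' v) e mulr0.
by case/eqP: b'b; rewrite -vv'.
Qed.

Lemma canonical_series_solution : is_weight_vector A beta w ->
  canonical_series `<=` log_free_solutions A beta w.
Proof.
move=> [_ [U wU]] _ [v [ev vmin] <-]; apply: lspan_in; split.
  exact: phi_directed wU ev.
exact: phi_solution ev vmin.
Qed.

End Basis.

Theorem theorem5p4 (R : realType) (d n : nat) (A : 'M[int]_(d, n))
    (hA : columns_generate A) (beta : 'cV[R[i]]_d) (w : 'cV[R]_n)
    (hw : is_weight_vector A beta w) :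
  is_basis [set phi A v | v in [set v | is_exponent A beta w v /\ min_nsupp A v]]
           (log_free_solutions A beta w).
Proof.
split; [exact: canonical_series_solution| |exact: canonical_series_indep].
by apply: lspan_sub => f [df sf]; exact: directed_solution_span.
Qed.
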